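(* The following is a basis for the $\mathbb F$-vector space $\Delta_q$: $$A^i C^j B^k\Omega^\ell\alpha^r\beta^s\gamma^t,\qquad j\in\{0,1\},\qquad i,k,\ell,r,s,t\in\mathbb N.$$
   Context: Algebras are associative with multiplicative identity $1$. $\mathbb F$ is a field and $q\in\mathbb F$ is nonzero with $q^4\neq 1$. $\mathbb N=\{0,1,2,\ldots\}$. The universal Askey--Wilson algebra $\Delta_q$ is the $\mathbb F$-algebra defined by generators $A,B,C$ and the relations asserting that each of $$A+\frac{qBC-q^{-1}CB}{q^2-q^{-2}},\qquad B+\frac{qCA-q^{-1}AC}{q^2-q^{-2}},\qquad C+\frac{qAB-q^{-1}BA}{q^2-q^{-2}}$$ is central in $\Delta_q$. The central elements $\alpha,\beta,\gamma$ of $\Delta_q$ are obtained by multiplying these three elements, respectively, by $q+q^{-1}$. The Casimir element of $\Delta_q$ is $$\Omega=q^{-1}ACB+q^{-2}A^2+q^{-2}B^2+q^{2}C^2-q^{-1}A\alpha-q^{-1}B\beta-qC\gamma;$$ it is known to be central in $\Delta_q$. *)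

(* Defs.v *)
From HB Require Import structures.
From mathcomp Require Import all_boot all_algebra boolp monalg.

Set Implicit Arguments.
Unset Strict Implicit.
Unset Printing Implicit Defensive.

Import GRing.Theory.

Local Open Scope ring_scope.
Local Open Scope quotient_scope.

Section Basis.
Variables (F : fieldType) (V : lmodType F) (I : eqType).

Definition lin_indep (v : I -> V) : Prop :=
  forall (s : seq I) (c : I -> F), uniq s ->
    \sum_(i <- s) c i *: v i = 0 -> {in s, forall i, c i = 0}.

Definition spanning (v : I -> V) : Prop :=
  forall x : V, exists (s : seq I) (c : I -> F), x = \sum_(i <- s) c i *: v i.

Definition is_basis (v : I -> V) : Prop := lin_indep v /\ spanning v.

End Basis.

Section FreeAlgebra.
Variables (F : fieldType) (I : choiceType).

(* The library has an [algType] instance on [malg] only over commutative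
   monomials, hence the alias. *)
Definition freeAlg : predArgType := {malg F[{fmonom I}]}.

HB.instance Definition _ := GRing.Lalgebra.on freeAlg.

Fact malg_scaleAr (c : F) (x y : {malg F[{fmonom I}]}) :
  c *: (x * y) = x * (c *: y).
Proof.
have cC (z : {malg F[{fmonom I}]}) :
    c *: z = z * (c%:MP : {malg F[{fmonom I}]}).
  rewrite -mul_malgC !malgM_def fgmulUg fgmulgU.
  by apply: eq_bigr => k _; rewrite mul1m mulm1 mulrC.
by rewrite !cC mulrA.
Qed.

HB.instance Definition _ :=
  GRing.Lalgebra_isAlgebra.Build F freeAlg malg_scaleAr.

Definition freeGen (i : I) : freeAlg := << fmu i >>.

(* The constant coefficient *)
Definition freeAug : freeAlg -> F := mcoeff (mone : {fmonom I}).

HB.instance Definition _ := GRing.RMorphism.on freeAug.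

End FreeAlgebra.

Section QuotientAlgebra.
Variables (F : fieldType) (E : algType F) (S : E -> Prop).

(* The two-sided ideal generated by S *)
Inductive idealGen : E -> Prop :=
| idealGen_mem x of S x : idealGen x
| idealGen0 : idealGen 0
| idealGenD x y of idealGen x & idealGen y : idealGen (x + y)
| idealGenMl a x of idealGen x : idealGen (a * x)
| idealGenMr a x of idealGen x : idealGen (x * a).

Definition idealPred : {pred E} := fun x => `[< idealGen x >].

Fact idealPredP x : reflect (idealGen x) (x \in idealPred).
Proof. exact: asboolP. Qed.

Fact idealPredMl a x : x \in idealPred -> a * x \in idealPred.
Proof. by move=> /idealPredP xI; apply/idealPredP/idealGenMl. Qed.

Fact idealPredMr a x : x \in idealPred -> x * a \in idealPred.
Proof. by move=> /idealPredP xI; apply/idealPredP/idealGenMr. Qed.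

Fact idealPred_zmod_closed : zmod_closed idealPred.
Proof.
split=> [|x y xI yI]; first by apply/idealPredP/idealGen0.
apply/idealPredP/idealGenD; apply/idealPredP => //.
by rewrite -mulN1r idealPredMl.
Qed.

HB.instance Definition _ :=
  GRing.isZmodClosed.Build E idealPred idealPred_zmod_closed.

(* [algType] requires nonzero rings, so the type records that the ideal is
   proper. *)
Definition quotAlg (S_proper : ~ idealGen 1) : predArgType :=
  {ideal_quot (idealPred : zmodClosed E)}.

Variable S_proper : ~ idealGen 1.
Local Notation Q := (quotAlg S_proper).

HB.instance Definition _ := GRing.Zmodule.on Q.
HB.instance Definition _ := EqQuotient.on Q.

Definition quotPi (x : E) : Q := \pi_Q x.

Fact quotPi_eq x y : quotPi x = quotPi y <-> x - y \in idealPred.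
Proof. by rewrite Quotient.idealrBE; split=> [/eqP //|xy]; apply/eqP. Qed.

Fact quotPiK x : quotPi (repr x) = x.
Proof. exact: reprK. Qed.

Fact repr_quotPi x : repr (quotPi x) - x \in idealPred.
Proof. by apply/quotPi_eq; rewrite quotPiK. Qed.

Fact quotPiD x y : quotPi (x + y) = quotPi x + quotPi y.
Proof. exact: Quotient.pi_add. Qed.

Fact quotPiN x : quotPi (- x) = - quotPi x.
Proof. exact: Quotient.pi_opp. Qed.

Fact quotPiB : {morph quotPi : x y / x - y}.
Proof. by move=> x y; rewrite quotPiD quotPiN. Qed.

Fact quotPi0 : quotPi 0 = 0.
Proof. by rewrite -(subrr 0) quotPiB subrr. Qed.

Definition quotOne : Q := lift_cst Q 1.
Definition quotMul : Q -> Q -> Q := lift_op2 Q *%R.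
Definition quotScale (c : F) : Q -> Q := lift_op1 Q ( *:%R c).

Fact quotPi1 : quotPi 1 = quotOne.
Proof. by rewrite /quotOne -lock. Qed.

Fact quotPiM : {morph quotPi : x y / x * y >-> quotMul x y}.
Proof.
move=> x y; rewrite /quotMul -lock; apply/esym/quotPi_eq.
set x' := repr _; set y' := repr _.
have -> : x' * y' - x * y = (x' - x) * y' + x * (y' - y).
  by rewrite mulrBl mulrBr addrA subrK.
by apply: rpredD; [apply: idealPredMr | apply: idealPredMl];
   apply: repr_quotPi.
Qed.

Fact quotPiZ c : {morph quotPi : x / c *: x >-> quotScale c x}.
Proof.
move=> x; rewrite /quotScale -lock; apply/esym/quotPi_eq.
rewrite -scalerBr -[_ - x]mul1r scalerAl.
exact/idealPredMl/repr_quotPi.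
Qed.

Fact quotMulA : associative quotMul.
Proof.
move=> x y z; rewrite -[x]quotPiK -[y]quotPiK -[z]quotPiK.
by rewrite -!quotPiM mulrA.
Qed.

Fact quotMul1 : left_id quotOne quotMul.
Proof. by move=> x; rewrite -[x]quotPiK -quotPi1 -quotPiM mul1r. Qed.

Fact quotMulr1 : right_id quotOne quotMul.
Proof. by move=> x; rewrite -[x]quotPiK -quotPi1 -quotPiM mulr1. Qed.

Fact quotMulDl : left_distributive quotMul +%R.
Proof.
move=> x y z; rewrite -[x]quotPiK -[y]quotPiK -[z]quotPiK.
by rewrite -quotPiD -!quotPiM -quotPiD mulrDl.
Qed.

Fact quotMulDr : right_distributive quotMul +%R.
Proof.
move=> x y z; rewrite -[x]quotPiK -[y]quotPiK -[z]quotPiK.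
by rewrite -quotPiD -!quotPiM -quotPiD mulrDr.
Qed.

Fact quotOne_neq0 : quotOne != 0.
Proof.
apply/eqP; rewrite -quotPi1 -quotPi0 => /quotPi_eq.
by rewrite subr0 => /idealPredP.
Qed.

HB.instance Definition _ := GRing.Zmodule_isNzRing.Build Q
  quotMulA quotMul1 quotMulr1 quotMulDl quotMulDr quotOne_neq0.

Fact quotScaleA a b x : quotScale a (quotScale b x) = quotScale (a * b) x.
Proof. by rewrite -[x]quotPiK -!quotPiZ scalerA. Qed.

Fact quotScale1 : left_id 1 quotScale.
Proof. by move=> x; rewrite -[x]quotPiK -quotPiZ scale1r. Qed.

Fact quotScaleDr : right_distributive quotScale +%R.
Proof.
move=> c x y; rewrite -[x]quotPiK -[y]quotPiK.
by rewrite -quotPiD -!quotPiZ -quotPiD scalerDr.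
Qed.

Fact quotScaleDl x : {morph quotScale^~ x : a b / a + b}.
Proof. by move=> a b; rewrite -[x]quotPiK -!quotPiZ -quotPiD scalerDl. Qed.

HB.instance Definition _ := GRing.Zmodule_isLmodule.Build F Q
  quotScaleA quotScale1 quotScaleDr quotScaleDl.

Fact quotScaleAl (c : F) (x y : Q) : c *: (x * y) = (c *: x) * y.
Proof.
change (quotScale c (quotMul x y) = quotMul (quotScale c x) y).
by rewrite -[x]quotPiK -[y]quotPiK -!(quotPiM, quotPiZ) scalerAl.
Qed.

Fact quotScaleAr (c : F) (x y : Q) : c *: (x * y) = x * (c *: y).
Proof.
change (quotScale c (quotMul x y) = quotMul x (quotScale c y)).
by rewrite -[x]quotPiK -[y]quotPiK -!(quotPiM, quotPiZ) scalerAr.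
Qed.

HB.instance Definition _ := GRing.Lmodule_isLalgebra.Build F Q quotScaleAl.
HB.instance Definition _ := GRing.Lalgebra_isAlgebra.Build F Q quotScaleAr.

HB.instance Definition _ := GRing.isZmodMorphism.Build E Q quotPi quotPiB.
HB.instance Definition _ :=
  GRing.isMonoidMorphism.Build E Q quotPi (quotPi1, quotPiM).
HB.instance Definition _ := GRing.isScalable.Build F E Q *:%R quotPi quotPiZ.

End QuotientAlgebra.

Section AskeyWilsonElements.
Variables (F : fieldType) (E : algType F) (q : F).

(* [AWmid A B C], [AWmid B C A], [AWmid C A B] are the three elements required
   to be central. *)
Definition AWmid (x y z : E) : E :=
  x + (q ^+ 2 - q ^- 2)^-1 *: (q *: (y * z) - q^-1 *: (z * y)).

Definition AWalpha (A B C : E) : E := (q + q^-1) *: AWmid A B C.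
Definition AWbeta (A B C : E) : E := (q + q^-1) *: AWmid B C A.
Definition AWgamma (A B C : E) : E := (q + q^-1) *: AWmid C A B.

Definition AWOmega (A B C : E) : E :=
  q^-1 *: (A * C * B) + q ^- 2 *: A ^+ 2 + q ^- 2 *: B ^+ 2 + q ^+ 2 *: C ^+ 2
  - q^-1 *: (A * AWalpha A B C) - q^-1 *: (B * AWbeta A B C)
  - q *: (C * AWgamma A B C).

(* Centrality of the three elements, as the set of commutators to be killed *)
Definition AWrel (A B C : E) (x : E) : Prop :=
  exists z u : E,
    [\/ z = AWmid A B C, z = AWmid B C A | z = AWmid C A B]
    /\ x = z * u - u * z.

End AskeyWilsonElements.

Section UniversalAskeyWilson.
Variables (F : fieldType) (q : F).

Definition AWletter : choiceType := 'I_3.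
Local Notation freeABC := (freeAlg F AWletter).

Definition freeA : freeABC := freeGen F (@Ordinal 3 0 isT : AWletter).
Definition freeB : freeABC := freeGen F (@Ordinal 3 1 isT : AWletter).
Definition freeC : freeABC := freeGen F (@Ordinal 3 2 isT : AWletter).

Fact AWproper : ~ idealGen (AWrel q freeA freeB freeC) 1.
Proof.
suff aug0 x : idealGen (AWrel q freeA freeB freeC) x -> freeAug x = 0.
  by move/aug0/eqP; rewrite rmorph1 oner_eq0.
elim=> {x} [_ [z [u [_ ->]]]||x y _ x0 _ y0|a x _ x0|a x _ x0].
- by rewrite rmorphB !rmorphM /= [_ * freeAug z]mulrC subrr.
- exact: rmorph0.
- by rewrite rmorphD /= x0 y0 addr0.
- by rewrite rmorphM /= x0 mulr0.
- by rewrite rmorphM /= x0 mul0r.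
Qed.

(* The universal Askey-Wilson algebra, defined for every q *)
Definition AW : algType F := quotAlg AWproper.

Definition AW_A : AW := quotPi AWproper freeA.
Definition AW_B : AW := quotPi AWproper freeB.
Definition AW_C : AW := quotPi AWproper freeC.

Definition AW_alpha : AW := AWalpha q AW_A AW_B AW_C.
Definition AW_beta : AW := AWbeta q AW_A AW_B AW_C.
Definition AW_gamma : AW := AWgamma q AW_A AW_B AW_C.
Definition AW_Omega : AW := AWOmega q AW_A AW_B AW_C.

End UniversalAskeyWilson.

(* Main.v *)
Require Import Defs.
From HB Require Import structures.
From mathcomp Require Import all_boot all_algebra finmap monalg ring.

Set Implicit Arguments.
Unset Strict Implicit.
Unset Printing Implicit Defensive.

Import GRing.Theory.

Local Open Scope ring_scope.

(** Put rho = q^2 - q^-2 and eta = q - q^-1; both are nonzero.  In these terms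
    the definitions of alpha, beta, gamma and Omega say
    -  q BC - q^-1 CB = eta alpha - rho A,
    -  q CA - q^-1 AC = eta beta - rho B,
    -  q AB - q^-1 BA = eta gamma - rho C,
    -  q^2 C^2 = Omega - q^-1 ACB + (a linear combination of A^2, B^2, A alpha,
       B beta and C gamma),
    which are rewriting rules for the words BC, CA, BA and CC.  The words in
    A, B, C that contain none of these four are the A^i C^j B^k with j <= 1.

    Spanning.  The span of the proposed basis contains 1, so it suffices that
    it is stable under left multiplication by A, B and C.  For A this is clear;
    for B and C it follows by induction on the exponent of A ([in_spanBC]): the
    rules for BA and CA lower it, and when it is zero the rules for BC and CC
    apply.  The last rule leaves Omega on the left of a power of B, so one needs
    B Omega = Omega B ([AWOmega_commB]), a direct computation.

    Independence.  Let R be the polynomial ring over F in five variables b, om,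
    al, be, ga, and let V be the free R-module with basis x_i, y_i (i >= 0).
    These stand for A^i and A^i C, with b playing the role of multiplication by
    B on the right.  The operator A shifts the index; B and C are prescribed on
    x_0 and y_0 by the rules for BC and CC, and on A v through the rules for BA
    and CA.  Hence beta and gamma act on V as the scalars be and ga by
    construction.  The remaining point is that
    q BC - q^-1 CB + rho A - eta al vanishes on V ([model_alpha_defect]).  It
    commutes with A ([alpha_defectA]), as a formal consequence of the rules for
    BA and CA, so that it is enough to evaluate it at x_0, where it vanishes by
    construction, and at y_0, where the rule for CC makes it vanish
    ([alpha_defect_x], [alpha_defect_y]).  So V is a module over the algebra,
    and Omega x_0 = om x_0 by the value of C y_0.  Therefore
    A^i C^j B^k Omega^l alpha^r beta^s gamma^t sends x_0 to
    b^k om^l al^r be^s ga^t times x_i or y_i according to j, and these vectors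
    are linearly independent over F. *)

(** * Linear identities through a square-zero extension *)

Section TrivialExtension.
Variables (R : comNzRingType) (V : lmodType R).

(** The ring R (+) V in which V squares to zero.  It is commutative, so an
    R-linear identity between vectors of V becomes an identity of commutative
    rings, within reach of [ring]. *)
Definition trivExt : Type := (R * V)%type.
HB.instance Definition _ := GRing.Zmodule.on trivExt.

Definition trivMul (x y : trivExt) : trivExt :=
  (x.1 * y.1, x.1 *: y.2 + y.1 *: x.2).

Fact trivMulA : associative trivMul.
Proof.
case=> [a u] [b v] [c w]; rewrite /trivMul /= mulrA; congr (_, _).
by rewrite !scalerDr !scalerA addrA [c * a]mulrC [c * b]mulrC.
Qed.

Fact trivMulC : commutative trivMul.
Proof. by case=> [a u] [b v]; rewrite /trivMul /= mulrC addrC. Qed.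

Fact trivMul1 : left_id ((1, 0) : trivExt) trivMul.
Proof. by case=> [a u]; rewrite /trivMul /= mul1r scale1r scaler0 addr0. Qed.

Fact trivMulDl : left_distributive trivMul +%R.
Proof.
case=> [a u] [b v] [c w]; rewrite /trivMul /= mulrDl; congr (_, _).
by rewrite scalerDl scalerDr addrACA.
Qed.

Fact trivOne_neq0 : ((1, 0) : trivExt) != 0.
Proof. by rewrite xpair_eqE oner_eq0. Qed.

HB.instance Definition _ := GRing.Zmodule_isComNzRing.Build trivExt
  trivMulA trivMulC trivMul1 trivMulDl trivOne_neq0.

Definition triv_scal (c : R) : trivExt := (c, 0).
Definition triv_vec (v : V) : trivExt := (0, v).

Fact triv_scalB : {morph triv_scal : x y / x - y}.
Proof. by move=> x y; congr (_, _); rewrite subr0. Qed.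

Fact triv_scalM : {morph triv_scal : x y / x * y}.
Proof. by move=> x y; congr (_, _); rewrite /= !scaler0 addr0. Qed.

HB.instance Definition _ :=
  GRing.isZmodMorphism.Build R trivExt triv_scal triv_scalB.
HB.instance Definition _ :=
  GRing.isMonoidMorphism.Build R trivExt triv_scal (erefl, triv_scalM).

Lemma triv_vec_inj : injective triv_vec.
Proof. by move=> u v []. Qed.

Lemma triv_vecZ c v : triv_vec (c *: v) = triv_scal c * triv_vec v.
Proof. by congr (_, _); rewrite /= ?mulr0 ?scale0r ?addr0. Qed.

Lemma triv_vecD : {morph triv_vec : u v / u + v}.
Proof. by move=> u v; congr (_, _); rewrite addr0. Qed.

Lemma triv_vecN : {morph triv_vec : u / - u}.
Proof. by move=> u; congr (_, _); rewrite oppr0. Qed.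

Lemma triv_vec0 : triv_vec 0 = 0.
Proof. by []. Qed.

Definition triv_vecE := (triv_vecD, triv_vecN, triv_vec0, triv_vecZ).

Lemma triv_scal_inv (q p : R) : q * p = 1 -> triv_scal q * triv_scal p = 1.
Proof. by move=> qp; rewrite -rmorphM qp rmorph1. Qed.

End TrivialExtension.

(** Proves an equality of linear combinations whose coefficients agree modulo
    [qp : q * p = 1]; vectors other than sums and multiples are atoms. *)
Ltac lmod_ring qp :=
  apply: triv_vec_inj;
  lazymatch goal with |- @eq _ (@triv_vec _ ?V _) _ =>
    rewrite !triv_vecE; ring: (triv_scal_inv V qp)
  end.

(** * Linear extension from a basis *)

Lemma malg_ind (F : nzRingType) (I : choiceType) (P : {malg F[I]} -> Prop) :
    P 0 -> (forall g h, P g -> P h -> P (g + h)) ->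
    (forall c g, P g -> P (c *: g)) -> (forall k, P << k >>) ->
  forall g, P g.
Proof.
move=> P0 PD PZ PU g; rewrite [g]monalgE; elim/big_ind: _ => // k _.
have -> : << g@_k *g k >> = g@_k *: << k >> :> {malg F[I]}.
  by apply/malgP => l; rewrite mcoeffZ !mcoeffU mulr_natr.
exact/PZ/PU.
Qed.

Lemma malg_linear_eq0 (R : comNzRingType) (I : choiceType) (W : lmodType R)
    (f : {malg R[I]} -> W) :
  linear f -> (forall k, f << k >> = 0) -> forall g, f g = 0.
Proof.
move=> f_lin fU.
have f0 : f 0 = 0.
  by have := f_lin (-1) 0 0; rewrite scaleN1r oppr0 addr0 scaleN1r addNr.
elim/malg_ind=> [|g h fg fh|c g fg|k]; first exact: f0.
- by rewrite -[g]scale1r f_lin fg fh scaler0 addr0.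
- by rewrite -[c *: g]addr0 f_lin fg f0 scaler0 addr0.
- exact: fU.
Qed.

Lemma malgUM (R : nzRingType) (K : monomType) (m n : K) :
  << m >> * << n >> = << mmul m n >> :> {malg R[K]}.
Proof. by rewrite malgM_def fgmulUU mulr1. Qed.

Lemma malgUX (R : nzRingType) (K : monomType) (m : K) n :
  << m >> ^+ n = << iter n (mmul m) mone >> :> {malg R[K]}.
Proof. by elim: n => [|n IHn]; rewrite ?expr0 // exprS IHn malgUM. Qed.

Section LinearExtension.
Variables (F R : comNzRingType) (iota : {rmorphism F -> R}).
Variables (I : choiceType) (V : lmodType R) (v : I -> V).

(** The coefficients are carried along [iota] because vectors of an R-module
    will be combined with coefficients in F. *)
Definition linext (g : {malg F[I]}) : V :=
  \sum_(k <- msupp g) iota g@_k *: v k.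

Lemma linextEw (d : {fset I}) g : (msupp g `<=` d)%fset ->
  linext g = \sum_(k <- d) iota g@_k *: v k.
Proof.
move=> le; rewrite /linext (big_fset_incl _ le) // => k _ /mcoeff_outdom ->.
by rewrite rmorph0 scale0r.
Qed.

Lemma linextB : {morph linext : g h / g - h}.
Proof.
move=> g h; pose d := (msupp g `|` msupp h)%fset.
rewrite (@linextEw d (g - h)) ?(@linextEw d g) ?(@linextEw d h).
- by rewrite -sumrB; apply: eq_bigr => k _; rewrite mcoeffB rmorphB scalerBl.
- exact: fsubsetUr.
- exact: fsubsetUl.
- exact: msuppB_le.
Qed.

HB.instance Definition _ :=
  GRing.isZmodMorphism.Build {malg F[I]} V linext linextB.

Lemma linextZ c g : linext (c *: g) = iota c *: linext g.
Proof.
rewrite (linextEw (msuppZ_le _ _)) scaler_sumr; apply: eq_bigr => k _.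
by rewrite mcoeffZ rmorphM scalerA.
Qed.

Lemma linextU k : linext << k >> = v k.
Proof.
by rewrite (linextEw msuppU_le) big_seq_fset1 mcoeffUU rmorph1 scale1r.
Qed.

End LinearExtension.

Section LinearOperator.
Variables (R : comNzRingType) (I : choiceType) (V : lmodType R) (v : I -> V).

Definition linop : {malg R[I]} -> V := linext idfun v.

HB.instance Definition _ := GRing.Additive.on linop.
Fact linop_scalable : scalable linop.
Proof. exact: linextZ. Qed.
HB.instance Definition _ :=
  GRing.isScalable.Build R {malg R[I]} V *:%R linop linop_scalable.

Lemma linopU k : linop << k >> = v k.
Proof. exact: linextU. Qed.

End LinearOperator.

Lemma linear_lincomb (F : nzRingType) (U V : lmodType F) (f : {linear U -> V})
    (I : Type) (s : seq I) (c : I -> F) (m : I -> U) :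
  f (\sum_(n <- s) c n *: m n) = \sum_(n <- s) c n *: f (m n).
Proof. by rewrite linear_sum; apply: eq_bigr => n _; rewrite linearZ. Qed.

(** * The relations as rewriting rules, and the Casimir element *)

Lemma scaler_central (F : fieldType) (E : algType F) (c : F) (z : E) :
  (forall u, z * u = u * z) -> forall u, (c *: z) * u = u * (c *: z).
Proof. by move=> zC u; rewrite -scalerAl -scalerAr zC. Qed.

Section Relations.
Variables (F : fieldType) (E : algType F) (q : F).
Hypotheses (q_neq0 : q != 0) (q4_neq1 : q ^+ 4 != 1).

Let qV : q * q^-1 = 1. Proof. exact: divff. Qed.

Lemma rho_neq0 : q ^+ 2 - q ^- 2 != 0.
Proof.
apply: contra q4_neq1 => /eqP rho0.
have -> : q ^+ 4 = 1 + q ^+ 2 * (q ^+ 2 - q ^- 2) by field.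
by rewrite rho0 mulr0 addr0.
Qed.

Lemma rhoE : (q - q^-1) * (q + q^-1) = q ^+ 2 - q ^- 2.
Proof. by field. Qed.

Lemma kappa_neq0 : q + q^-1 != 0.
Proof. by apply: contraNneq rho_neq0 => kappa0; rewrite -rhoE kappa0 mulr0. Qed.

(** Stated for [AWalpha] only: [AWbeta q A B C] and [AWgamma q A B C] are
    [AWalpha q B C A] and [AWalpha q C A B]. *)
Lemma AWalpha_qcomm (x y z : E) :
  q *: (y * z) - q^-1 *: (z * y)
  = (q - q^-1) *: AWalpha q x y z - (q ^+ 2 - q ^- 2) *: x.
Proof.
rewrite /AWalpha /AWmid scalerA rhoE scalerDr scalerA divff ?rho_neq0 //.
by rewrite scale1r addrAC subrr add0r.
Qed.

Lemma AWalpha_swap (x y z : E) :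
  y * z = q^-1 ^+ 2 *: (z * y)
  + q^-1 *: ((q - q^-1) *: AWalpha q x y z - (q ^+ 2 - q^-1 ^+ 2) *: x).
Proof. have := AWalpha_qcomm x y z; rewrite -exprVn => <-; lmod_ring qV. Qed.

Lemma AWalpha_swapV (x y z : E) :
  z * y = q ^+ 2 *: (y * z)
  - q *: ((q - q^-1) *: AWalpha q x y z - (q ^+ 2 - q^-1 ^+ 2) *: x).
Proof. have := AWalpha_qcomm x y z; rewrite -exprVn => <-; lmod_ring qV. Qed.

Lemma AWOmega_square (A B C : E) :
  C * C = q^-1 ^+ 2 *: (AWOmega q A B C - q^-1 *: (A * C * B)
  - q^-1 ^+ 2 *: (A * A) - q^-1 ^+ 2 *: (B * B)
  + q^-1 *: (A * AWalpha q A B C) + q^-1 *: (B * AWbeta q A B C)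
  + q *: (C * AWgamma q A B C)).
Proof. by rewrite /AWOmega -!exprVn !expr2; lmod_ring qV. Qed.

(** Among the terms of Omega, B fails to commute with ACB, A^2, C^2, A alpha
    and C gamma.  The rules for BA and BC give the five commutators in the
    words A^2 B, C^2 B, AC, CA and words with a central factor, where they
    cancel.  The words AC and CA occur only as q AC + q^-1 CA, from A^2 and from
    C^2 with opposite coefficients, so that no product CA has to be reordered. *)
Lemma AWOmega_commB (A B C : E) :
    (forall u, AWalpha q A B C * u = u * AWalpha q A B C) ->
    (forall u, AWbeta q A B C * u = u * AWbeta q A B C) ->
    (forall u, AWgamma q A B C * u = u * AWgamma q A B C) ->
  B * AWOmega q A B C = AWOmega q A B C * B.
Proof.
have BC := AWalpha_swap A B C.
have BA : B * A = q ^+ 2 *: (A * B)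
    - q *: ((q - q^-1) *: AWgamma q A B C - (q ^+ 2 - q^-1 ^+ 2) *: C).
  exact: AWalpha_swapV.
rewrite /AWOmega -!exprVn !expr2.
move: (AWalpha q A B C) (AWbeta q A B C) (AWgamma q A B C) BC BA
  => a b c BC BA aC bC cC.
move: (q^-1) qV BC BA => p qp.
set rho := q ^+ 2 - p ^+ 2; set eta := q - p => BC BA.
have lE := (mulrDl, mulrDr, mulNr, mulrN, =^~scalerAl, =^~scalerAr).
have BACB : B * (A * C * B) = A * C * B * B + q *: (rho *: (C * C * B)
    - eta *: (c * (C * B)) + eta *: (a * (A * B)) - rho *: (A * A * B)).
  rewrite !mulrA BA !lE -(mulrA A B C) BC !lE !mulrA -(aC A).
  by rewrite /rho /eta; lmod_ring qp.
have BCC : q ^+ 2 *: (B * (C * C)) = q ^+ 2 *: (C * C * B) - rho *: (C * C * B)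
    + rho *: (a * C) - rho *: (q *: (A * C) + p *: (C * A)).
  rewrite !mulrA BC !lE -(mulrA C B C) BC !lE !mulrA -(aC C).
  by rewrite /rho /eta; lmod_ring qp.
have BAA : p ^+ 2 *: (B * (A * A)) = p ^+ 2 *: (A * A * B) + rho *: (A * A * B)
    - rho *: (c * A) + rho *: (p *: (C * A) + q *: (A * C)).
  rewrite !mulrA BA !lE -(mulrA A B A) BA !lE !mulrA -(cC A).
  by rewrite /rho /eta; lmod_ring qp.
rewrite !lE BACB -!expr2 BCC BAA.
rewrite (mulrA B A) BA -(aC A) -(bC B) -(cC C).
rewrite (mulrA B b) -(bC B) (mulrA B c) -(cC B) -[c * B * C]mulrA BC.
rewrite !lE -(aC (A * B)) -!mulrA -?(cC C) -?(aC C).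
rewrite /rho /eta; lmod_ring qp.
Qed.

End Relations.

(** * The monomials span *)

Section Span.
Variables (F : fieldType) (I : choiceType) (E : algType F) (v : I -> E).

Definition in_span (x : E) : Prop := exists g, x = linext idfun v g.

Lemma spanning_in_span : (forall x, in_span x) -> spanning v.
Proof.
by move=> span_v x; have [g ->] := span_v x; exists (msupp g), (mcoeff^~ g).
Qed.

Lemma in_span_mem i : in_span (v i).
Proof. by exists << i >>; rewrite linextU. Qed.

Lemma in_span0 : in_span 0.
Proof. by exists 0; rewrite raddf0. Qed.

Lemma in_spanD x y : in_span x -> in_span y -> in_span (x + y).
Proof. by move=> [g ->] [h ->]; exists (g + h); rewrite raddfD. Qed.

Lemma in_spanZ c x : in_span x -> in_span (c *: x).
Proof. by move=> [g ->]; exists (c *: g); rewrite linextZ. Qed.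

Lemma in_spanN x : in_span x -> in_span (- x).
Proof. by rewrite -scaleN1r; apply: in_spanZ. Qed.

Lemma in_span_ind (P : E -> Prop) :
    P 0 -> (forall x y, P x -> P y -> P (x + y)) ->
    (forall c x, P x -> P (c *: x)) -> (forall i, P (v i)) ->
  forall x, in_span x -> P x.
Proof.
move=> P0 PD PZ PU x [g ->]; elim/malg_ind: g => [|g h|c g|i].
- by rewrite raddf0.
- by rewrite raddfD; apply: PD.
- by rewrite linextZ; apply: PZ.
- by rewrite linextU.
Qed.

Lemma in_spanMl a : (forall i, in_span (a * v i)) ->
  forall x, in_span x -> in_span (a * x).
Proof.
move=> av; apply: in_span_ind => [|x y|c x|//].
- by rewrite mulr0; apply: in_span0.
- by rewrite mulrDr; apply: in_spanD.
- by rewrite -scalerAr; apply: in_spanZ.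
Qed.

Lemma in_spanMr a : (forall i, in_span (v i * a)) ->
  forall x, in_span x -> in_span (x * a).
Proof.
move=> av; apply: in_span_ind => [|x y|c x|//].
- by rewrite mul0r; apply: in_span0.
- by rewrite mulrDl; apply: in_spanD.
- by rewrite -scalerAl; apply: in_spanZ.
Qed.

End Span.

Definition ordered_monomial (F : fieldType) (E : algType F)
    (A B C Omega alpha beta gamma : E)
    (n : nat * 'I_2 * nat * nat * nat * nat * nat) : E :=
  let: (i, j, k, l, r, s, t) := n in
  A ^+ i * C ^+ j * B ^+ k * Omega ^+ l * alpha ^+ r * beta ^+ s * gamma ^+ t.

(** The seven elements are arbitrary, subject to the rewriting rules: the
    formulas defining Omega, alpha, beta and gamma must not be unfolded by the
    distributivity rewrites below. *)
Section MonomialSpan.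
Variables (F : fieldType) (E : algType F) (q : F).
Variables A B C Omega alpha beta gamma : E.

Hypothesis alphaC : forall u, alpha * u = u * alpha.
Hypothesis betaC : forall u, beta * u = u * beta.
Hypothesis gammaC : forall u, gamma * u = u * gamma.
Hypothesis Omega_commB : B * Omega = Omega * B.
Hypothesis BC : B * C = q^-1 ^+ 2 *: (C * B)
  + q^-1 *: ((q - q^-1) *: alpha - (q ^+ 2 - q^-1 ^+ 2) *: A).
Hypothesis CA : C * A = q^-1 ^+ 2 *: (A * C)
  + q^-1 *: ((q - q^-1) *: beta - (q ^+ 2 - q^-1 ^+ 2) *: B).
Hypothesis BA : B * A = q ^+ 2 *: (A * B)
  - q *: ((q - q^-1) *: gamma - (q ^+ 2 - q^-1 ^+ 2) *: C).
Hypothesis CC : C * C = q^-1 ^+ 2 *: (Omega - q^-1 *: (A * C * B)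
  - q^-1 ^+ 2 *: (A * A) - q^-1 ^+ 2 *: (B * B) + q^-1 *: (A * alpha)
  + q^-1 *: (B * beta) + q *: (C * gamma)).

Local Notation mon := (ordered_monomial A B C Omega alpha beta gamma).
Local Notation U := (in_span mon).

Lemma in_spanA x : U x -> U (A * x).
Proof.
apply: in_spanMl => -[[[[[[i j] k] l] r] s] t].
suff -> : A * mon (i, j, k, l, r, s, t) = mon (i.+1, j, k, l, r, s, t).
  exact: in_span_mem.
by rewrite /ordered_monomial exprS !mulrA.
Qed.

Lemma in_span_gamma x : U x -> U (x * gamma).
Proof.
apply: in_spanMr => -[[[[[[i j] k] l] r] s] t].
suff -> : mon (i, j, k, l, r, s, t) * gamma = mon (i, j, k, l, r, s, t.+1).
  exact: in_span_mem.
by rewrite /ordered_monomial [gamma ^+ t.+1]exprSr !mulrA.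
Qed.

Lemma in_span_beta x : U x -> U (x * beta).
Proof.
apply: in_spanMr => -[[[[[[i j] k] l] r] s] t].
suff -> : mon (i, j, k, l, r, s, t) * beta = mon (i, j, k, l, r, s.+1, t).
  exact: in_span_mem.
rewrite /ordered_monomial [beta ^+ s.+1]exprSr -!(mulrA _ _ (gamma ^+ t)).
by rewrite -!mulrA betaC !mulrA.
Qed.

Lemma in_span_alpha x : U x -> U (x * alpha).
Proof.
apply: in_spanMr => -[[[[[[i j] k] l] r] s] t].
suff -> : mon (i, j, k, l, r, s, t) * alpha = mon (i, j, k, l, r.+1, s, t).
  exact: in_span_mem.
by rewrite /ordered_monomial [alpha ^+ r.+1]exprSr -!mulrA alphaC !mulrA.
Qed.

Lemma in_span_Omega x : U x -> U (x * Omega).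
Proof.
apply: in_spanMr => -[[[[[[i j] k] l] r] s] t].
suff -> : mon (i, j, k, l, r, s, t) * Omega = mon (i, j, k, l.+1, r, s, t).
  exact: in_span_mem.
have Omega_comm : GRing.comm Omega (alpha ^+ r * (beta ^+ s * gamma ^+ t)).
  by do !apply: commrM; apply: commrX; apply/commr_sym => //; red.
rewrite /ordered_monomial [Omega ^+ l.+1]exprSr -!mulrA.
by move: Omega_comm; rewrite /GRing.comm -!mulrA => <-.
Qed.

Lemma in_spanBC0 (j : 'I_2) k l r s t :
  U (B * mon (0, j, k, l, r, s, t)) /\ U (C * mon (0, j, k, l, r, s, t)).
Proof.
have [Z ZE] : exists Z, Z = Omega ^+ l * (alpha ^+ r * (beta ^+ s * gamma ^+ t)).
  by eexists.
have OmegaZ : Omega * Z = Z * Omega.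
  rewrite ZE; do !apply: commrM; apply: commrX => //;
  by apply/commr_sym => //; red.
have UZ (i : nat) (j' : 'I_2) m : U (A ^+ i * C ^+ j' * (B ^+ m * Z)).
  have := in_span_mem mon (i, j', m, l, r, s, t).
  by rewrite /ordered_monomial ZE !mulrA.
have UB m : U (B ^+ m * Z).
  by have := UZ 0 (@Ordinal 2 0 isT) m; rewrite !expr0 !mul1r.
have UCB m : U (C * (B ^+ m * Z)).
  by have := UZ 0 (@Ordinal 2 1 isT) m; rewrite expr0 mul1r.
have -> : mon (0, j, k, l, r, s, t) = C ^+ j * (B ^+ k * Z).
  by rewrite /ordered_monomial expr0 mul1r ZE !mulrA.
have BX m : B * (B ^+ m * Z) = B ^+ m.+1 * Z by rewrite mulrA -exprS.
have OmegaBZ : Omega * (B ^+ k * Z) = B ^+ k * Z * Omega.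
  by apply: commrM => //; exact: commrX.
case: j => [[|[|//]] j2] /=; rewrite ?expr0 ?mul1r ?expr1 ?BX //.
split; rewrite mulrA.
  rewrite BC !(mulrDl, mulNr, =^~scalerAl) -!mulrA alphaC BX.
  do !(apply: in_spanD || apply: in_spanZ || apply: in_spanN) => //.
  - exact: in_span_alpha.
  - exact: in_spanA.
rewrite CC !(mulrDl, mulNr, =^~scalerAl) -!(mulrA _ _ (B ^+ k * Z)).
rewrite -(mulrA A C) OmegaBZ alphaC betaC gammaC !BX.
do !(apply: in_spanD || apply: in_spanZ || apply: in_spanN).
- exact: in_span_Omega.
- exact/in_spanA/UCB.
- exact/in_spanA/in_spanA.
- exact: UB.
- exact/in_spanA/in_span_alpha.
- by rewrite mulrA BX; apply: in_span_beta.
- by rewrite mulrA; apply: in_span_gamma.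
Qed.

(** B and C are treated together because the rule for BA produces C and the
    rule for CA produces B. *)
Lemma in_spanBC x : U x -> U (B * x) /\ U (C * x).
Proof.
suff BCmon n : U (B * mon n) /\ U (C * mon n).
  by move=> Ux; split; apply: in_spanMl Ux => n; have [] := BCmon n.
case: n => [[[[[[i j] k] l] r] s] t].
elim: i => [|i [IHB IHC]]; first exact: in_spanBC0.
have -> : mon (i.+1, j, k, l, r, s, t) = A * mon (i, j, k, l, r, s, t).
  by rewrite /ordered_monomial exprS !mulrA.
have := in_span_mem mon (i, j, k, l, r, s, t).
move: (mon _) IHB IHC => w IHB IHC Uw.
rewrite !mulrA BA CA !(mulrDl, mulNr, =^~scalerAl) -!mulrA betaC gammaC.
split; do !(apply: in_spanD || apply: in_spanZ || apply: in_spanN) => //.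
- exact: in_spanA.
- exact: in_span_gamma.
- exact: in_spanA.
- exact: in_span_beta.
Qed.

Lemma in_span1 : U 1.
Proof.
have := in_span_mem mon (0, @Ordinal 2 0 isT, 0, 0, 0, 0, 0).
by rewrite /ordered_monomial !expr0 !mulr1.
Qed.

End MonomialSpan.

Lemma freeAlg_ind (F : fieldType) (J : choiceType) (P : freeAlg F J -> Prop) :
    P 0 -> (forall x y, P x -> P y -> P (x + y)) ->
    (forall c x, P x -> P (c *: x)) -> P 1 ->
    (forall i x, P x -> P (freeGen F i * x)) -> forall x, P x.
Proof.
move=> P0 PD PZ P1 PM; apply: malg_ind => // w.
rewrite -[w]fmK; elim: (w : seq J) => [|i s IHs].
  by move: P1; congr (P _); rewrite -fmoneE.
move/(PM i): IHs; congr (P _).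
by rewrite /freeGen malgUM; congr << _ >>; rewrite /mmul /= fmmulE fmuE.
Qed.

Section Morphism.
Variables (F : fieldType) (E E' : algType F) (q : F).
Variable f : {lrmorphism E -> E'}.

Lemma lrmorph_AWmid (x y z : E) :
  f (AWmid q x y z) = AWmid q (f x) (f y) (f z).
Proof. by rewrite /AWmid linearD linearZ linearB !linearZ /= !rmorphM. Qed.

Lemma lrmorph_monomial (A B C : E) n :
  f (ordered_monomial A B C (AWOmega q A B C)
       (AWalpha q A B C) (AWbeta q A B C) (AWgamma q A B C) n)
  = ordered_monomial (f A) (f B) (f C) (AWOmega q (f A) (f B) (f C))
      (AWalpha q (f A) (f B) (f C)) (AWbeta q (f A) (f B) (f C))
      (AWgamma q (f A) (f B) (f C)) n.
Proof.
have fE : (forall c u, f (c *: u) = c *: f u)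
    * (forall u v, f (u * v) = f u * f v)
    * (forall u v, f (u - v) = f u - f v)
    * (forall u v, f (u + v) = f u + f v)
    * (forall u k, f (u ^+ k) = f u ^+ k).
  by do !split=> *; rewrite ?linearZ ?rmorphM ?raddfB ?raddfD ?rmorphXn.
have falpha x y z : f (AWalpha q x y z) = AWalpha q (f x) (f y) (f z).
  by rewrite /AWalpha fE lrmorph_AWmid.
have fOmega : f (AWOmega q A B C) = AWOmega q (f A) (f B) (f C).
  by rewrite /AWOmega !(fE, falpha).
case: n => [[[[[[i j] k] l] r] s] t].
by rewrite /ordered_monomial !(fE, falpha, fOmega).
Qed.

End Morphism.

Lemma AWmid_central (F : fieldType) (q : F) (z : AW q) :
    [\/ z = AWmid q (AW_A q) (AW_B q) (AW_C q),
        z = AWmid q (AW_B q) (AW_C q) (AW_A q) |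
        z = AWmid q (AW_C q) (AW_A q) (AW_B q)] ->
  forall u, z * u = u * z.
Proof.
have mid := lrmorph_AWmid q (quotPi (AWproper (q:=q))).
rewrite -!mid => zE u; rewrite -[u]quotPiK.
set u' := repr u.
have [z' z'E ->] : exists2 z',
    [\/ z' = AWmid q (freeA F) (freeB F) (freeC F),
        z' = AWmid q (freeB F) (freeC F) (freeA F) |
        z' = AWmid q (freeC F) (freeA F) (freeB F)]
    & z = quotPi (AWproper (q:=q)) z'.
  by case: zE => ->; eexists; try reflexivity;
    [constructor 1 | constructor 2 | constructor 3].
rewrite -!rmorphM; apply/quotPi_eq/idealPredP/idealGen_mem.
by exists z', u'.
Qed.

Lemma AW_spanning (F : fieldType) (q : F) (q_neq0 : q != 0)
    (q4_neq1 : q ^+ 4 != 1) :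
  spanning (ordered_monomial (AW_A q) (AW_B q) (AW_C q) (AW_Omega q)
                             (AW_alpha q) (AW_beta q) (AW_gamma q)).
Proof.
apply: spanning_in_span => x; rewrite -[x]quotPiK.
have alphaC : forall u, AW_alpha q * u = u * AW_alpha q.
  by apply/scaler_central/AWmid_central; constructor 1.
have betaC : forall u, AW_beta q * u = u * AW_beta q.
  by apply/scaler_central/AWmid_central; constructor 2.
have gammaC : forall u, AW_gamma q * u = u * AW_gamma q.
  by apply/scaler_central/AWmid_central; constructor 3.
have Omega_commB := AWOmega_commB q_neq0 q4_neq1 alphaC betaC gammaC.
have BC := AWalpha_swap q_neq0 q4_neq1 (AW_A q) (AW_B q) (AW_C q).
have CA := AWalpha_swap q_neq0 q4_neq1 (AW_B q) (AW_C q) (AW_A q).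
have BA := AWalpha_swapV q_neq0 q4_neq1 (AW_C q) (AW_A q) (AW_B q).
have CC := AWOmega_square q_neq0 (AW_A q) (AW_B q) (AW_C q).
elim/freeAlg_ind: (repr x) => [|y z Uy Uz|c y Uy||i y Uy].
- by rewrite raddf0; apply: in_span0.
- by rewrite raddfD; apply: in_spanD.
- by rewrite linearZ; apply: in_spanZ.
- by rewrite rmorph1; apply: in_span1.
have [UB UC] := in_spanBC alphaC betaC gammaC Omega_commB BC CA BA CC Uy.
case: i => [[|[|[|//]]] i3].
- rewrite (_ : Ordinal i3 = @Ordinal 3 0 isT); last exact: val_inj.
  by rewrite rmorphM; apply: in_spanA.
- rewrite (_ : Ordinal i3 = @Ordinal 3 1 isT); last exact: val_inj.
  by rewrite rmorphM; apply: UB.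
- rewrite (_ : Ordinal i3 = @Ordinal 3 2 isT); last exact: val_inj.
  by rewrite rmorphM; apply: UC.
Qed.

(** * Actions of a free algebra *)

Section FreeAction.
Variables (F : fieldType) (R : comNzRingType) (iota : {rmorphism F -> R}).
Variables (J : choiceType) (V : lmodType R) (g : J -> {linear V -> V}).

Definition word_act (w : {fmonom J}) (v : V) : V :=
  foldr (fun i => g i) v w.

Definition free_act (x : freeAlg F J) (v : V) : V :=
  linext iota (word_act^~ v) x.

Lemma word_actP (w : {fmonom J}) : linear (word_act w).
Proof.
rewrite /word_act => c u v.
by elim: (w : seq J) => //= i s ->; rewrite linearP.
Qed.

Lemma free_actP x : linear (free_act x).
Proof.
move=> c u v; rewrite /free_act /linext scaler_sumr -big_split /=.
by apply: eq_bigr => w _; rewrite word_actP scalerDr !scalerA mulrC.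
Qed.

HB.instance Definition _ x :=
  GRing.isLinear.Build R V V *:%R (free_act x) (free_actP x).

Lemma free_actDl x y v : free_act (x + y) v = free_act x v + free_act y v.
Proof. exact: raddfD. Qed.

Lemma free_actBl x y v : free_act (x - y) v = free_act x v - free_act y v.
Proof. exact: raddfB. Qed.

Lemma free_act0l v : free_act 0 v = 0.
Proof. exact: raddf0. Qed.

Lemma free_actZl c x v : free_act (c *: x) v = iota c *: free_act x v.
Proof. exact: linextZ. Qed.

Lemma free_act1 v : free_act 1 v = v.
Proof. by rewrite /free_act linextU /word_act /= fm1. Qed.

Lemma free_actM (x y : freeAlg F J) v :
  free_act (x * y) v = free_act x (free_act y v).
Proof.
elim/malg_ind: x => [|x x' IHx IHx'|c x IHx|w].
- by rewrite mul0r !free_act0l.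
- by rewrite mulrDl (free_actDl (x * y)) (free_actDl x); congr (_ + _).
- by rewrite -scalerAl [LHS]free_actZl [in RHS]free_actZl; congr (_ *: _).
elim/malg_ind: y => [|y y' IHy IHy'|c y IHy|w'].
- by rewrite mulr0 !free_act0l linear0.
- rewrite mulrDr (free_actDl (_ * y)) (free_actDl y) linearD.
  by congr (_ + _).
- have -> : << w >> * (c *: y) = c *: (<< w >> * y) by rewrite malg_scaleAr.
  rewrite [LHS]free_actZl [in RHS]free_actZl linearZ.
  by congr (_ *: _).
by rewrite malgUM /free_act !linextU /word_act fmM foldr_cat.
Qed.

Lemma free_act_gen i v : free_act (freeGen F i) v = g i v.
Proof. by rewrite /free_act linextU /word_act fmuE. Qed.

Lemma free_act_lincomb (I : Type) (s : seq I) (c : I -> F)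
    (m : I -> freeAlg F J) (v : V) :
  free_act (\sum_(n <- s) c n *: m n) v
  = \sum_(n <- s) iota (c n) *: free_act (m n) v.
Proof.
elim: s => [|n s IHs]; first by rewrite !big_nil free_act0l.
by rewrite !big_cons free_actDl free_actZl IHs.
Qed.

End FreeAction.

(** * Operators subject to the rewriting rules *)

Section Defects.
Variables (R : comNzRingType) (q p b om al be ga : R).
Hypothesis qp : q * p = 1.
Variables (V : lmodType R) (A B C : {linear V -> V}).

Local Notation rho := (q ^+ 2 - p ^+ 2).
Local Notation eta := (q - p).

Definition alpha_defect (v : V) : V :=
  q *: B (C v) - p *: C (B v) + rho *: A v - eta *: (al *: v).
Definition beta_defect (v : V) : V :=
  C (A v) - (p ^+ 2 *: A (C v) + p *: (eta *: (be *: v) - rho *: B v)).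
Definition gamma_defect (v : V) : V :=
  B (A v) - (q ^+ 2 *: A (B v) - q *: (eta *: (ga *: v) - rho *: C v)).

(* A rewrite with the generic linearity lemmas would not terminate: scaling is
   itself linear, so that nested scalars could be exchanged for ever. *)
Let linE (f : {linear V -> V}) : (forall u w, f (u + w) = f u + f w)
  * (forall u, f (- u) = - f u) * (forall c u, f (c *: u) = c *: f u).
Proof.
by split; [split=> *; rewrite ?linearD ?linearN | move=> c u; rewrite linearZ].
Qed.

Lemma alpha_defectP : linear alpha_defect.
Proof. by move=> c u v; rewrite /alpha_defect !linearP; lmod_ring qp. Qed.
Lemma beta_defectP : linear beta_defect.
Proof. by move=> c u v; rewrite /beta_defect !linearP; lmod_ring qp. Qed.
Lemma gamma_defectP : linear gamma_defect.
Proof. by move=> c u v; rewrite /gamma_defect !linearP; lmod_ring qp. Qed.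

Hypothesis beta_defect0 : forall v, beta_defect v = 0.
Hypothesis gamma_defect0 : forall v, gamma_defect v = 0.

Lemma op_CA v :
  C (A v) = p ^+ 2 *: A (C v) + p *: (eta *: (be *: v) - rho *: B v).
Proof. exact/subr0_eq/beta_defect0. Qed.

Lemma op_BA v :
  B (A v) = q ^+ 2 *: A (B v) - q *: (eta *: (ga *: v) - rho *: C v).
Proof. exact/subr0_eq/gamma_defect0. Qed.

(** Moving A to the left through BC and CB produces C^2, B^2, and multiples of
    B and C, each with coefficients that cancel in q BC - q^-1 CB. *)
Lemma alpha_defectA v : alpha_defect (A v) = A (alpha_defect v).
Proof.
rewrite /alpha_defect !(op_BA, op_CA) !(linE A, linE B, linE C).
rewrite !(op_BA, op_CA); lmod_ring qp.
Qed.

Variable x : V.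
Let y := C x.
Hypothesis Bx : B x = b *: x.
Hypothesis By :
  B y = p ^+ 2 *: (b *: y) + p *: (eta *: (al *: x) - rho *: A x).
Hypothesis Cy :
  C y = p ^+ 2 *: (om *: x - p *: (b *: A y) - p ^+ 2 *: A (A x)
                   - p ^+ 2 *: (b ^+ 2 *: x) + p *: (al *: A x)
                   + p *: (b *: (be *: x)) + q *: (ga *: y)).

Lemma alpha_defect_x : alpha_defect x = 0.
Proof. by rewrite /alpha_defect -/y By Bx (linE C) -/y; lmod_ring qp. Qed.

(** The overlap of the rules for BC and CC in the word BCC. *)
Lemma alpha_defect_y : alpha_defect y = 0.
Proof.
have Cx : C x = y by []; clearbody y.
rewrite /alpha_defect Cy By.
rewrite !(linE A, linE B, linE C, op_BA, op_CA, Bx, Cx, By, Cy).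
lmod_ring qp.
Qed.

End Defects.

Section Representation.
Variables (F : fieldType) (q : F).
Hypotheses (q_neq0 : q != 0) (q4_neq1 : q ^+ 4 != 1).
Variables (R : comNzRingType) (iota : {rmorphism F -> R}) (b om al be ga : R).
Variables (E : algType F) (V : lmodType R) (act : E -> {linear V -> V}).
Hypothesis act_sub : forall x y v, act (x - y) v = act x v - act y v.
Hypothesis act_scale : forall c x v, act (c *: x) v = iota c *: act x v.
Hypothesis act_mul : forall x y v, act (x * y) v = act x (act y v).
Hypothesis act_one : forall v, act 1 v = v.

Let Q := iota q.
Let P := iota q^-1.

Lemma act_param_inv : Q * P = 1.
Proof. by rewrite -rmorphM divff ?rmorph1. Qed.

Lemma act_opp x v : act (- x) v = - act x v.
Proof. by have := act_scale (-1) x v; rewrite rmorphN1 !scaleN1r => ->. Qed.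

Lemma act_add x y v : act (x + y) v = act x v + act y v.
Proof. by rewrite -{1}[y]opprK act_sub act_opp opprK. Qed.

Lemma actX_scalar x c v :
  act x v = c *: v -> forall n, act (x ^+ n) v = c ^+ n *: v.
Proof.
move=> xv; elim=> [|n IHn]; first by rewrite !expr0 scale1r act_one.
by rewrite !exprSr act_mul xv linearZ /= IHn scalerA mulrC.
Qed.

Lemma act_qcomm (x y z : E) (m : R) (v : V) :
    Q *: act y (act z v) - P *: act z (act y v)
      = (Q - P) *: (m *: v) - (Q ^+ 2 - P ^+ 2) *: act x v ->
  act (AWalpha q x y z) v = m *: v.
Proof.
move=> qcomm.
have eta_neq0 : q - q^-1 != 0.
  apply: contraNneq (rho_neq0 q_neq0 q4_neq1) => eta0.
  by apply/eqP; rewrite -(rhoE q_neq0) eta0 mul0r.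
have etaK : injective ( *:%R (Q - P) : V -> V).
  apply: (can_inj (g := *:%R (iota (q - q^-1)^-1))) => u.
  by rewrite scalerA -rmorphB -rmorphM mulVf // rmorph1 scale1r.
have := congr1 (fun w => act w v) (AWalpha_qcomm q_neq0 q4_neq1 x y z).
rewrite !(act_sub, act_scale, act_mul) qcomm -exprVn !rmorphB !rmorphXn /=.
by move/addIr/etaK.
Qed.

Lemma act_mid_scalar (x y z : E) (m : R) (v : V) :
  act (AWalpha q x y z) v = m *: v ->
  act (AWmid q x y z) v = (iota (q + q^-1)^-1 * m) *: v.
Proof.
rewrite -scalerA => <-; rewrite -act_scale scalerA mulVf ?scale1r //.
exact: kappa_neq0.
Qed.

Variables (A B C : E) (opA opB opC : {linear V -> V}).
Hypothesis actA : forall v, act A v = opA v.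
Hypothesis actB : forall v, act B v = opB v.
Hypothesis actC : forall v, act C v = opC v.
Hypothesis alpha_defect0 : forall v, alpha_defect Q P al opA opB opC v = 0.
Hypothesis beta_defect0 : forall v, beta_defect Q P be opA opB opC v = 0.
Hypothesis gamma_defect0 : forall v, gamma_defect Q P ga opA opB opC v = 0.

Lemma act_alpha v : act (AWalpha q A B C) v = al *: v.
Proof.
apply: act_qcomm; rewrite !(actA, actB, actC).
by have /subr0_eq <- := alpha_defect0 v; rewrite addrK.
Qed.

Lemma act_beta v : act (AWbeta q A B C) v = be *: v.
Proof.
apply: act_qcomm; rewrite !(actA, actB, actC) (op_CA beta_defect0).
lmod_ring act_param_inv.
Qed.

Lemma act_gamma v : act (AWgamma q A B C) v = ga *: v.
Proof.
apply: act_qcomm; rewrite !(actA, actB, actC) (op_BA gamma_defect0).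
lmod_ring act_param_inv.
Qed.

Lemma act_AWrel x v : AWrel q A B C x -> act x v = 0.
Proof.
case=> z [u [zE ->]]; rewrite act_sub !act_mul.
have [m zm] : exists m, forall w, act z w = m *: w.
  by case: zE => ->; eexists => w; apply: act_mid_scalar;
    [apply: act_alpha | apply: act_beta | apply: act_gamma].
by rewrite !zm linearZ subrr.
Qed.

Lemma act_idealGen x v : idealGen (AWrel q A B C) x -> act x v = 0.
Proof.
move=> xI; elim: xI v => {x} [x xR|| x y _ x0 _ y0|a x _ x0|a x _ x0] v.
- exact: act_AWrel.
- by rewrite -(subrr 0) act_sub subrr.
- by rewrite act_add x0 y0 addr0.
- by rewrite act_mul x0 linear0.
- by rewrite act_mul x0.
Qed.

Variable x : V.
Let y := opC x.
Hypothesis Bx : opB x = b *: x.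
Hypothesis Cy :
  opC y = P ^+ 2 *: (om *: x - P *: (b *: opA y) - P ^+ 2 *: opA (opA x)
                     - P ^+ 2 *: (b ^+ 2 *: x) + P *: (al *: opA x)
                     + P *: (b *: (be *: x)) + Q *: (ga *: y)).

Lemma act_Omega : act (AWOmega q A B C) x = om *: x.
Proof.
have opZ (f : {linear V -> V}) c v : f (c *: v) = c *: f v by rewrite linearZ.
rewrite /AWOmega -!exprVn !expr2 !(act_sub, act_add, act_scale, act_mul,
  act_alpha, act_beta, act_gamma, actA, actB, actC, Bx).
rewrite -/y Cy !(opZ opA, opZ opB, opZ opC) -/y Bx !rmorphM -/Q -/P.
lmod_ring act_param_inv.
Qed.

(** Read from right to left: the central factors, then Omega, then B act on x
    as scalars, which leaves A^i C^j x. *)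
Lemma act_monomial (i : nat) (j : 'I_2) (k l r s t : nat) :
  act (ordered_monomial A B C (AWOmega q A B C) (AWalpha q A B C)
         (AWbeta q A B C) (AWgamma q A B C) (i, j, k, l, r, s, t)) x
  = (b ^+ k * om ^+ l * al ^+ r * be ^+ s * ga ^+ t)
      *: iter i opA (iter j opC x).
Proof.
have actX_iter u n v : act (u ^+ n) v = iter n (act u) v.
  by elim: n => [|n IHn]; rewrite ?expr0 ?act_one // exprS act_mul IHn.
have actZr u c v : act u (c *: v) = c *: act u v by rewrite linearZ.
rewrite /ordered_monomial !act_mul (actX_scalar (act_gamma x)) !actZr.
rewrite (actX_scalar (act_beta x)) !actZr (actX_scalar (act_alpha x)) !actZr.
rewrite (actX_scalar act_Omega) !actZr.
rewrite (actX_scalar (etrans (actB x) Bx)) !actZr !scalerA.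
rewrite !actX_iter (eq_iter actA) (eq_iter actC); congr (_ *: _); ring.
Qed.

End Representation.

(** * The model *)

Section Model.
Variables (R : comNzRingType) (q p b om al be ga : R).
Hypothesis qp : q * p = 1.

(* (i, false) indexes x_i and (i, true) indexes y_i. *)
Local Notation V := {malg R[(nat * bool)%type]}.
Local Notation rho := (q ^+ 2 - p ^+ 2).
Local Notation eta := (q - p).
Local Notation x_ n := (<< (n, false) >> : V).
Local Notation y_ n := (<< (n, true) >> : V).

Definition model_A : V -> V := linop (fun n => << (n.1.+1, n.2) >>).
HB.instance Definition _ := GRing.Linear.on model_A.

Definition model_BC_init (j : bool) : V * V :=
  if j then
    (p ^+ 2 *: (b *: y_ 0) + p *: (eta *: (al *: x_ 0) - rho *: x_ 1),
     p ^+ 2 *: (om *: x_ 0 - p *: (b *: y_ 1) - p ^+ 2 *: x_ 2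
                - p ^+ 2 *: (b ^+ 2 *: x_ 0) + p *: (al *: x_ 1)
                + p *: (b *: (be *: x_ 0)) + q *: (ga *: y_ 0)))
  else (b *: x_ 0, y_ 0).

(** The pair of the images under B and C, defined together because each of the
    rules for BA and CA involves both operators. *)
Fixpoint model_BC_basis (j : bool) (i : nat) : V * V :=
  if i is i'.+1 then
    let: (Bv, Cv) := model_BC_basis j i' in let v := << (i', j) >> in
    (q ^+ 2 *: model_A Bv - q *: (eta *: (ga *: v) - rho *: Cv),
     p ^+ 2 *: model_A Cv + p *: (eta *: (be *: v) - rho *: Bv))
  else model_BC_init j.

Definition model_B : V -> V := linop (fun n => (model_BC_basis n.2 n.1).1).
Definition model_C : V -> V := linop (fun n => (model_BC_basis n.2 n.1).2).
HB.instance Definition _ := GRing.Linear.on model_B.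
HB.instance Definition _ := GRing.Linear.on model_C.

Lemma model_AU n : model_A << n >> = << (n.1.+1, n.2) >>.
Proof. exact: linopU. Qed.

Lemma model_gamma_defect v :
  gamma_defect q p ga model_A model_B model_C v = 0.
Proof.
apply: malg_linear_eq0 v; first exact: gamma_defectP.
case=> i j; rewrite /gamma_defect /= model_AU /model_B /model_C !linopU /=.
by case: model_BC_basis => u w; rewrite subrr.
Qed.

Lemma model_beta_defect v : beta_defect q p be model_A model_B model_C v = 0.
Proof.
apply: malg_linear_eq0 v; first exact: beta_defectP.
case=> i j; rewrite /beta_defect /= model_AU /model_B /model_C !linopU /=.
by case: model_BC_basis => u w; rewrite subrr.
Qed.

Lemma model_B_x0 : model_B (x_ 0) = b *: x_ 0.
Proof. exact: linopU. Qed.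

Lemma model_C_x0 : model_C (x_ 0) = y_ 0.
Proof. exact: linopU. Qed.

Lemma model_B_y0 : model_B (y_ 0)
  = p ^+ 2 *: (b *: y_ 0) + p *: (eta *: (al *: x_ 0) - rho *: model_A (x_ 0)).
Proof. by rewrite model_AU; apply: linopU. Qed.

Lemma model_C_y0 : model_C (y_ 0) =
  p ^+ 2 *: (om *: x_ 0 - p *: (b *: model_A (y_ 0))
    - p ^+ 2 *: model_A (model_A (x_ 0))
    - p ^+ 2 *: (b ^+ 2 *: x_ 0) + p *: (al *: model_A (x_ 0))
    + p *: (b *: (be *: x_ 0)) + q *: (ga *: y_ 0)).
Proof. by rewrite !model_AU; apply: linopU. Qed.

Lemma model_alpha_defect v : alpha_defect q p al model_A model_B model_C v = 0.
Proof.
apply: malg_linear_eq0 v; first exact: alpha_defectP.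
case=> i j; elim: i => [|i IHi].
  have By := model_B_y0; have Cy := model_C_y0; rewrite -model_C_x0 in By Cy.
  case: j; last exact: alpha_defect_x model_B_x0 By.
  rewrite -model_C_x0.
  apply: alpha_defect_y model_beta_defect model_gamma_defect _ _ By Cy => //.
  exact: model_B_x0.
have -> : << (i.+1, j) >> = model_A << (i, j) >> by rewrite model_AU.
rewrite (alpha_defectA al qp model_beta_defect model_gamma_defect) IHi.
exact: linear0.
Qed.

End Model.

Section ActionOnModel.
Variables (F : fieldType) (q : F).
Hypotheses (q_neq0 : q != 0) (q4_neq1 : q ^+ 4 != 1).
Variables (R : comNzRingType) (iota : {rmorphism F -> R}) (b om al be ga : R).

Let Q := iota q.
Let P := iota q^-1.
Let QP : Q * P = 1 := act_param_inv q_neq0 iota.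

Local Notation V := {malg R[(nat * bool)%type]}.
Local Notation fA := (freeA F).
Local Notation fB := (freeB F).
Local Notation fC := (freeC F).
Local Notation opA := (@model_A R).
Local Notation opB := (model_B Q P b om al be ga).
Local Notation opC := (model_C Q P b om al be ga).

Definition letter_op (i : AWletter) : {linear V -> V} :=
  match val i with 0 => opA | 1 => opB | _ => opC end.

Lemma model_act_idealGen x v :
  idealGen (AWrel q fA fB fC) x -> free_act iota letter_op x v = 0.
Proof.
pose act y : {linear V -> V} := free_act iota letter_op y.
apply: (@act_idealGen F q q_neq0 q4_neq1 R iota al be ga _ V act
  (free_actBl _ _) (free_actZl _ _) (free_actM _ _) _ _ _ opA opB opC).
- exact: free_act_gen.
- exact: free_act_gen.
- exact: free_act_gen.
- exact: model_alpha_defect.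
- exact: model_beta_defect.
- exact: model_gamma_defect.
Qed.

Lemma model_act_monomial (i : nat) (j : 'I_2) (k l r s t : nat) :
  free_act iota letter_op
    (ordered_monomial fA fB fC (AWOmega q fA fB fC) (AWalpha q fA fB fC)
       (AWbeta q fA fB fC) (AWgamma q fA fB fC) (i, j, k, l, r, s, t))
    << (0, false) >>
  = (b ^+ k * om ^+ l * al ^+ r * be ^+ s * ga ^+ t)
      *: << (i, j == 1 :> nat) >>.
Proof.
pose act y : {linear V -> V} := free_act iota letter_op y.
have iterE : iter i opA (iter j opC << (0, false) >>)
    = << (i, j == 1 :> nat) >>.
  have -> : iter j opC << (0, false) >> = << (0, j == 1 :> nat) >>.
    by case: j => [[|[|//]] j2] //; apply: model_C_x0.
  by elim: i => //= i ->; apply: model_AU.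
rewrite -iterE.
apply: (@act_monomial F q q_neq0 q4_neq1 R iota b om al be ga _ V act
  (free_actBl _ _) (free_actZl _ _) (free_actM _ _) (free_act1 _ _)
  _ _ _ opA opB opC).
- exact: free_act_gen.
- exact: free_act_gen.
- exact: free_act_gen.
- exact: model_alpha_defect.
- exact: model_beta_defect.
- exact: model_gamma_defect.
- exact: model_B_x0.
- by rewrite /= model_C_x0; apply: model_C_y0.
Qed.

End ActionOnModel.

(** * The monomials are independent *)

Lemma malgUX5 (R : nzRingType) (K : monomType) (m0 m1 m2 m3 m4 : K) k l r s t :
  << m0 >> ^+ k * << m1 >> ^+ l * << m2 >> ^+ r * << m3 >> ^+ s * << m4 >> ^+ t
  = << mmul (mmul (mmul (mmul (iter k (mmul m0) mone) (iter l (mmul m1) mone))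
         (iter r (mmul m2) mone)) (iter s (mmul m3) mone))
         (iter t (mmul m4) mone) >>
  :> {malg R[K]}.
Proof. by rewrite !malgUX !malgUM. Qed.

Lemma cmon_iterE (i j : 'I_5) n :
  (iter n (mmul (ucm i)) mone) j = (n * (i == j))%N.
Proof.
by elim: n => [|n IHn]; rewrite /= ?cm1 // cmM IHn cmU mulSn.
Qed.

(** Five algebraically independent elements, with the coefficient functionals
    that witness this.  The existential form keeps the polynomial ring from
    being unfolded in the sequel. *)
Lemma independent_parameters (F : fieldType) :
  exists (R : comNzRingType) (iota : {rmorphism F -> R}) (b om al be ga : R)
    (coef : nat * nat * nat * nat * nat -> {additive R -> F}),
  forall (c : F) k l r s t n,
    coef n (iota c * (b ^+ k * om ^+ l * al ^+ r * be ^+ s * ga ^+ t))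
    = c *+ ((k, l, r, s, t) == n).
Proof.
pose m (n : nat * nat * nat * nat * nat) : {cmonom 'I_5} :=
  let: (k, l, r, s, t) := n in
  mmul (mmul (mmul (mmul (iter k (mmul (ucm (@Ordinal 5 0 isT))) mone)
    (iter l (mmul (ucm (@Ordinal 5 1 isT))) mone))
    (iter r (mmul (ucm (@Ordinal 5 2 isT))) mone))
    (iter s (mmul (ucm (@Ordinal 5 3 isT))) mone))
    (iter t (mmul (ucm (@Ordinal 5 4 isT))) mone).
have mE k l r s t (i : 'I_5) :
    m (k, l, r, s, t) i = nth 0 [:: k; l; r; s; t] i.
  rewrite !cmM !cmon_iterE.
  by case: i => [[|[|[|[|[|//]]]]] i5]; rewrite /= ?muln0 ?muln1 ?addn0 ?add0n.
exists {malg F[{cmonom 'I_5}]}, malgC.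
exists << ucm (@Ordinal 5 0 isT) >>, << ucm (@Ordinal 5 1 isT) >>.
exists << ucm (@Ordinal 5 2 isT) >>, << ucm (@Ordinal 5 3 isT) >>.
exists << ucm (@Ordinal 5 4 isT) >>.
exists (fun n => mcoeff (m n)).
move=> c k l r s t [[[[k' l'] r'] s'] t'].
rewrite malgUX5 mul_malgC /= mcoeffZ -/(m (k, l, r, s, t)) mcoeffU1 mulr_natr.
congr (_ *+ nat_of_bool _); apply/eqP/eqP => [eq_m|[-> -> -> -> ->] //].
have eq_nth (i : 'I_5) :
    nth 0 [:: k; l; r; s; t] i = nth 0 [:: k'; l'; r'; s'; t'] i.
  by rewrite -!mE eq_m.
have /= -> := eq_nth (@Ordinal 5 0 isT).
have /= -> := eq_nth (@Ordinal 5 1 isT).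
have /= -> := eq_nth (@Ordinal 5 2 isT).
have /= -> := eq_nth (@Ordinal 5 3 isT).
by have /= -> := eq_nth (@Ordinal 5 4 isT).
Qed.

(** A vanishing combination lifts to the free algebra as an element of the
    defining ideal, hence kills x_0; the coefficient of each monomial can then
    be read off in the model. *)
Lemma AW_lin_indep (F : fieldType) (q : F) (q_neq0 : q != 0)
    (q4_neq1 : q ^+ 4 != 1) :
  lin_indep (ordered_monomial (AW_A q) (AW_B q) (AW_C q) (AW_Omega q)
                              (AW_alpha q) (AW_beta q) (AW_gamma q)).
Proof.
move=> s c s_uniq sum0 n0 n0s.
pose mon n := ordered_monomial (freeA F) (freeB F) (freeC F)
  (AWOmega q (freeA F) (freeB F) (freeC F))
  (AWalpha q (freeA F) (freeB F) (freeC F))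
  (AWbeta q (freeA F) (freeB F) (freeC F))
  (AWgamma q (freeA F) (freeB F) (freeC F)) n.
pose f : {lrmorphism freeAlg F AWletter -> AW q} := quotPi (AWproper (q:=q)).
have fmon n : f (mon n) = _ := lrmorph_monomial q f _ _ _ n.
have mem_ideal : idealGen (AWrel q (freeA F) (freeB F) (freeC F))
    (\sum_(n <- s) c n *: mon n).
  apply/idealPredP; rewrite -[X in X \in _]subr0.
  apply/(@quotPi_eq _ _ _ (AWproper (q:=q))).
  rewrite quotPi0 -[RHS]sum0 -[LHS]/(f _) linear_lincomb.
  by apply: eq_bigr => n _; congr (_ *: _); apply: fmon.
have [R [iota [b [om [al [be [ga [coef coefE]]]]]]]] :=
  independent_parameters F.
have := model_act_idealGen q_neq0 q4_neq1 iota b om al be ga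
  << (0, false) >> mem_ideal.
rewrite free_act_lincomb.
move: n0s; case: n0 => [[[[[[i0 j0] k0] l0] r0] s0] t0] n0s.
move/(congr1 (fun v => coef (k0, l0, r0, s0, t0) v@_(i0, j0 == 1 :> nat))).
rewrite mcoeff0 raddf0 raddf_sum raddf_sum (bigD1_seq _ n0s s_uniq) /=.
rewrite big1 ?addr0 => [|[[[[[[i j] k] l] r] s1] t] n_neq0].
  rewrite model_act_monomial // !mcoeffZ mcoeffU eqxx mulr1n mulr1 coefE eqxx.
  by rewrite mulr1n.
rewrite model_act_monomial // !mcoeffZ mcoeffU mulrA mulr_natr raddfMn.
rewrite coefE; case: eqP => [[ek el er es et]|_]; last by rewrite mul0rn.
case: eqP => [[ei ej]|_]; last by rewrite mulr0n.
suff ejj : j = j0 by rewrite ei ejj ek el er es et eqxx in n_neq0.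
by apply: val_inj; move: ej; case: (j) (j0) => [[|[|//]] ?] [[|[|//]] ?].
Qed.

Theorem theorem2p20 (F : fieldType) (q : F) (q_neq0 : q != 0)
    (q4_neq1 : q ^+ 4 != 1) :
  is_basis (fun n : nat * 'I_2 * nat * nat * nat * nat * nat =>
    let: (i, j, k, l, r, s, t) := n in
    AW_A q ^+ i * AW_C q ^+ j * AW_B q ^+ k * AW_Omega q ^+ l
    * AW_alpha q ^+ r * AW_beta q ^+ s * AW_gamma q ^+ t).
Proof.
split; first exact: AW_lin_indep.
exact: AW_spanning.
Qed.
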